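(* For every positive integer $s$, $$\Big(\mathcal{D}_s\big(\Psi_{2s-1}(\mathbf{x}*\mathbf{y};t)\big)\Big)\Big|_{\mathbf{y}=0}=0,$$ where $\mathbf{x}=(x_1,\dots,x_s)$, $\mathbf{y}=(y_1,\dots,y_{s-1})$, $\mathbf{x}*\mathbf{y}=(x_1,y_1,\dots,x_{s-1},y_{s-1},x_s)$, and $$\mathcal{D}_s=\frac{\partial^s}{\partial x_1\cdots\partial x_s}-\prod_{i=1}^{s-1}\Big(\frac{\partial}{\partial x_i}+\frac{\partial}{\partial x_{i+1}}+t\frac{\partial}{\partial y_i}\Big).$$ Equivalently, $\frac{\partial^s}{\partial x_1\cdots\partial x_s}\Psi_s(\mathbf{x};t)=\Big(\prod_{i=1}^{s-1}\big(\frac{\partial}{\partial x_i}+\frac{\partial}{\partial x_{i+1}}+t\frac{\partial}{\partial y_i}\big)\Psi_{2s-1}(\mathbf{x}*\mathbf{y};t)\Big)\Big|_{\mathbf{y}=0}$.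
   Context: Ladder diagrams: $Q^+$ is the directed graph on $\mathbb{Z}_{\ge0}^2$ with edges $((i,j),(i,j+1))$ and $((i,j),(i+1,j))$. For a sequence $\mathbf{k}=(k_1,\dots,k_s)$ of positive integers with sum $n$, let $n_0=0$, $n_i=\sum_{j\le i}k_j$, $T_{\mathbf{k}}=\{(n_\ell,n-n_\ell):0\le\ell\le s\}$ (terminal vertices), and $\Gamma_{\mathbf{k}}$ the induced subgraph of $Q^+$ on $\{(a,b):a\le c,b\le d\text{ for some }(c,d)\in T_{\mathbf{k}}\}$. For a sequence of nonnegative integers, $\Gamma_{\mathbf{k}}$ is defined as $\Gamma$ of the subsequence of its positive entries (for the all-zero sequence this is the single vertex $(0,0)$, which is also its unique terminal vertex). A positive path is a shortest directed path from $(0,0)$ to a terminal vertex; a face of $\Gamma_{\mathbf{k}}$ is a subgraph containing all terminal vertices which is a union of positive paths; its dimension is $\operatorname{rank}H_1$ of it as a 1-dimensional CW complex. The $f$-polynomial is $F_{\mathbf{k}}(t)=\sum_\gamma t^{\dim\gamma}$ over all faces $\gamma$ of $\Gamma_{\mathbf{k}}$ (by Theorem 1.1, this is also the $f$-polynomial of the corresponding Gelfand–Cetlin polytope). The exponential generating function is the formal power series $\Psi_s(x_1,\dots,x_s;t)=\sum_{\mathbf{k}\in\mathbb{Z}_{\ge0}^s}F_{\mathbf{k}}(t)\frac{x_1^{k_1}\cdots x_s^{k_s}}{k_1!\cdots k_s!}$. *)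

(* Defs.v *)
From HB Require Import structures.
From mathcomp Require Import all_boot all_order all_algebra.
Unset Printing Implicit Defensive.
Import GRing.Theory.
Local Open Scope ring_scope.

(* k is a sequence of POSITIVE integers, n = sumn k.  Vertices of Gamma_k have
   both coordinates <= n, so we take the vertex type 'I_n.+1 * 'I_n.+1. *)
Definition vert (n : nat) := ('I_n.+1 * 'I_n.+1)%type.
Definition origin (n : nat) : vert n := (ord0, ord0).

Definition terminals (n : nat) (k : seq nat) : {set vert n} :=
  [set v : vert n | [exists l : 'I_(size k).+1,
     ((v.1 : nat) == sumn (take l k)) && ((v.2 : nat) == (n - sumn (take l k))%N)]].

Definition gvert (n : nat) (k : seq nat) : {set vert n} :=
  [set v : vert n | [exists w in terminals n k,
     ((v.1 : nat) <= w.1)%N && ((v.2 : nat) <= w.2)%N]].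

Definition gedge (n : nat) (k : seq nat) : rel (vert n) := fun u v =>
  [&& u \in gvert n k, v \in gvert n k &
     (((v.1 : nat) == u.1) && ((v.2 : nat) == (u.2).+1))
     || (((v.1 : nat) == (u.1).+1) && ((v.2 : nat) == u.2))].

(* positive paths: directed paths in Gamma_k from (0,0) to a terminal vertex
   (every directed path of Q^+ is shortest; since terminal vertices lie on
   a + b = n, all such paths have exactly n steps, listed after the origin) *)
Definition positive (n : nat) (k : seq nat) (p : n.-tuple (vert n)) : bool :=
  path (gedge n k) (origin n) (p : seq (vert n)) && (last (origin n) (p : seq (vert n)) \in terminals n k).

Definition pverts (n : nat) (p : n.-tuple (vert n)) : {set vert n} :=
  origin n |: [set v in (p : seq (vert n))].
Definition pedges (n : nat) (p : n.-tuple (vert n)) : {set vert n * vert n} :=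
  [set e in zip (origin n :: p) p].

Definition subgraph (n : nat) := ({set vert n} * {set vert n * vert n})%type.

Definition isface (n : nat) (k : seq nat) (g : subgraph n) : bool :=
  (terminals n k \subset g.1) &&
  [exists S : {set n.-tuple (vert n)},
     [&& [forall p in S, positive n k p],
         g.1 == \bigcup_(p in S) pverts n p &
         g.2 == \bigcup_(p in S) pedges n p]].

(* rank H_1 of a graph = #edges - #vertices + #connected components *)
Definition adj (n : nat) (g : subgraph n) : rel (vert n) := fun x y =>
  [&& x \in g.1, y \in g.1 & ((x, y) \in g.2) || ((y, x) \in g.2)].
Definition fdim (n : nat) (g : subgraph n) : nat :=
  (#|g.2| + n_comp (adj n g) (mem g.1) - #|g.1|)%N.

Definition facepoly (n : nat) (k : seq nat) : {poly rat} :=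
  \sum_(g : subgraph n | isface n k g) 'X^(fdim n g).

Definition Fpoly (k : seq nat) : {poly rat} :=
  let k' := [seq x <- k | (0 < x)%N] in facepoly (sumn k') k'.

(* a series is its (ordinary) coefficient function on exponent vectors *)
Definition fps (m : nat) := {ffun 'I_m -> nat} -> {poly rat}.

(* exponent of variable number i (0-based; 0 if out of range) *)
Definition expo (m : nat) (e : {ffun 'I_m -> nat}) (i : nat) : nat :=
  if insub i is Some j then e j else 0%N.
Definition incr (m : nat) (e : {ffun 'I_m -> nat}) (i : nat) : {ffun 'I_m -> nat} :=
  [ffun j => (e j + (val j == i))%N].

Definition Psi (m : nat) : fps m := fun e =>
  ((\prod_(i < m) (e i)`!)%:R)^-1 *: Fpoly [seq e i | i <- enum 'I_m].

Definition pd (m : nat) (i : nat) (f : fps m) : fps m := fun e =>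
  ((expo m e i).+1)%:R *: f (incr m e i).
Definition fadd (m : nat) (f g : fps m) : fps m := fun e => f e + g e.
Definition fsub (m : nat) (f g : fps m) : fps m := fun e => f e - g e.
Definition tmul (m : nat) (f : fps m) : fps m := fun e => 'X * f e.

(* Variables of Psi_{2s-1}(x*y): x*y = (x_1,y_1,...,x_{s-1},y_{s-1},x_s), so
   (0-based) x_{j+1} is variable 2j and y_{i+1} is variable 2i+1. *)
Definition dmixed (s : nat) (f : fps (s.*2.-1)) : fps (s.*2.-1) :=
  foldr (fun j h => pd (s.*2.-1) j.*2 h) f (iota 0 s).
Definition dprod (s : nat) (f : fps (s.*2.-1)) : fps (s.*2.-1) :=
  foldr (fun i h => fadd _ (fadd _ (pd _ i.*2 h) (pd _ i.*2.+2 h)) (tmul _ (pd _ i.*2.+1 h)))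
        f (iota 0 s.-1).
Definition Dop (s : nat) (f : fps (s.*2.-1)) : fps (s.*2.-1) :=
  fsub _ (dmixed s f) (dprod s f).

Definition ystar (s : nat) (a : {ffun 'I_s -> nat}) : {ffun 'I_(s.*2.-1) -> nat} :=
  [ffun j : 'I_(s.*2.-1) => if odd j then 0%N else expo s a (j./2)].
Definition yzero (s : nat) (f : fps (s.*2.-1)) : fps s := fun a => f (ystar s a).

(* Main.v *)
Require Import Defs.
From HB Require Import structures.
From mathcomp Require Import all_boot all_order all_algebra zify.
Import GRing.Theory.
Set Implicit Arguments.
Unset Strict Implicit.
Local Open Scope nat_scope.

(** A subgraph is a face exactly when it is locally one: every vertex other than
    the origin has an incoming edge, every vertex below the last antidiagonal has
    an outgoing edge, and its vertices on the last antidiagonal are the terminals.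
    Such a graph is connected, so its dimension is #E + 1 - #V.  Deleting the
    terminals of a face of Gamma_k (all k_i positive) therefore leaves a face of
    a ladder diagram of size n - 1, and the face is recovered from it by telling
    which edges enter each terminal.  The two extreme terminals have a single
    possible incoming edge; an inner one is entered vertically, horizontally, or
    by both edges, which moves the unit removed from its two neighbouring parts
    to the left part, to the right part, or to a new part 1 between them, and
    only in the last case changes the dimension, by one.  On coefficients of an
    exponential generating function partial derivatives are shifts, so this is
    the stated differential equation. *)

(** * Levels, steps and locally defined subgraphs *)

Definition lvl n (v : vert n) : nat := v.1 + v.2.

Definition vstep n (u v : vert n) : bool :=
  ((v.1 : nat) == u.1) && ((v.2 : nat) == u.2.+1).
Definition hstep n (u v : vert n) : bool :=
  ((v.1 : nat) == u.1.+1) && ((v.2 : nat) == u.2).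
Definition step n (u v : vert n) : bool := vstep u v || hstep u v.

(* [T] lists the first coordinates of the terminals, with possible repetitions. *)
Record locface n (T : seq nat) (g : subgraph n) : Prop := Locface {
  lf_origin : origin n \in g.1;
  lf_lvl : forall v : vert n, v \in g.1 -> lvl v <= n;
  lf_top : forall v : vert n, lvl v = n -> (v \in g.1) = ((v.1 : nat) \in T);
  lf_out : forall v : vert n, v \in g.1 -> lvl v < n -> exists w : vert n, (v, w) \in g.2;
  lf_in : forall v : vert n, v \in g.1 -> 0 < lvl v -> exists u : vert n, (u, v) \in g.2;
  lf_edge : forall u v : vert n, (u, v) \in g.2 -> [/\ u \in g.1, v \in g.1 & step u v]
}.

Definition locfaceb n (T : seq nat) (g : subgraph n) : bool :=
  [&& origin n \in g.1,
      [forall v in g.1, lvl v <= n],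
      [forall v : vert n, (lvl v == n) ==> ((v \in g.1) == ((v.1 : nat) \in T))],
      [forall v in g.1, (lvl v < n) ==> [exists w, (v, w) \in g.2]],
      [forall v in g.1, (0 < lvl v) ==> [exists u, (u, v) \in g.2]]
    & [forall e in g.2, [&& e.1 \in g.1, e.2 \in g.1 & step e.1 e.2]]].

Lemma locfaceP n T (g : subgraph n) : reflect (locface T g) (locfaceb T g).
Proof.
apply: (iffP and5P) => [[ho /forall_inP hl /forallP ht /forall_inP hout
    /andP[/forall_inP hin /forall_inP he]]|[ho hl ht hout hin he]].
  split=> // [v /eqP vn|v gv vn|v gv vn|u v /he /and3P[]//].
  - by move: (ht v); rewrite vn => /eqP.
  - by move: (hout v gv); rewrite vn => /existsP.
  - by move: (hin v gv); rewrite vn => /existsP.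
split=> //; last (apply/andP; split).
- by apply/forall_inP=> v /hl.
- by apply/forallP=> v; apply/implyP=> /eqP/ht ->.
- by apply/forall_inP=> v gv; apply/implyP=> /(hout v gv)/existsP.
- by apply/forall_inP=> v gv; apply/implyP=> /(hin v gv)/existsP.
- by apply/forall_inP=> -[u w] /he[-> -> ->].
Qed.

Lemma vert_eqP n (u v : vert n) :
  (u.1 : nat) = v.1 -> (u.2 : nat) = v.2 -> u = v.
Proof. by case: u v => [u1 u2] [v1 v2] /= /val_inj -> /val_inj ->. Qed.

Lemma lvl_origin n : lvl (origin n) = 0.
Proof. by []. Qed.

Lemma lvl_eq0 n (v : vert n) : lvl v = 0 -> v = origin n.
Proof. by rewrite /lvl => h; apply: vert_eqP => /=; lia. Qed.

Lemma step_lvl n (u v : vert n) : step u v -> lvl v = (lvl u).+1.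
Proof. by rewrite /step /vstep /hstep /lvl; lia. Qed.

Lemma step_le n (u v : vert n) : step u v -> u.1 <= v.1 /\ u.2 <= v.2.
Proof.
by case/orP=> /andP[/eqP -> /eqP ->]; rewrite ?leqnn ?leqnSn.
Qed.

Lemma step_path_lvl n (x : vert n) p : path (@step n) x p ->
  lvl (last x p) = lvl x + size p.
Proof.
elim: p x => [x _|y p IH x] /=; first by rewrite addn0.
by case/andP=> /step_lvl hy /IH ->; rewrite hy addnS.
Qed.

(** Cutting the vertex list at an edge leaves a prefix and a suffix that are paths again, the form
    in which edges of positive paths are used below. *)
Lemma mem_zip_split (T : eqType) (x : T) p e :
  reflect (exists p1 v p2, p = p1 ++ v :: p2 /\ e = (last x p1, v))
          (e \in zip (x :: p) p).
Proof.
apply: (iffP idP) => [|[p1 [v [p2 [-> ->]]]]].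
  elim: p x => [//|y p IH] x; rewrite inE => /orP[/eqP ->|/IH].
    by exists [::], y, p.
  by case=> p1 [v [p2 [-> ->]]]; exists (y :: p1), v, p2.
elim: p1 x => [|y p1 IH] x; first by rewrite inE eqxx.
by rewrite inE IH orbT.
Qed.

(** The offset [b] serves the inductions; [psums 0 k] lists the first coordinates of the terminals.
    A zero part only repeats an entry, so these lists are compared by [=i]. *)
Fixpoint psums (b : nat) (k : seq nat) : seq nat :=
  b :: (if k is x :: k' then psums (b + x) k' else [::]).

Lemma psumsP b k x :
  reflect (exists2 l, l <= size k & x = b + sumn (take l k)) (x \in psums b k).
Proof.
apply: (iffP idP).
  elim: k b => [|y k IH] b /=; rewrite inE.
    by move=> /eqP ->; exists 0; rewrite ?addn0.
  case/orP=> [/eqP ->|/IH[l hl ->]]; first by exists 0; rewrite ?addn0.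
  by exists l.+1; rewrite // /= addnA.
case=> l hl ->; elim: k b l hl => [|y k IH] b [|l] //= hl; rewrite inE ?addn0 ?eqxx //.
by rewrite addnA IH ?orbT.
Qed.

Lemma sumn_take_le l k : sumn (take l k) <= sumn k.
Proof. by rewrite -[X in _ <= sumn X](cat_take_drop l) sumn_cat leq_addr. Qed.

(** * Faces as locally defined subgraphs *)

Section IsFace.
Variables (n : nat) (k : seq nat).
Hypothesis nE : n = sumn k.

Lemma terminalsE (v : vert n) :
  (v \in terminals n k) = (lvl v == n) && ((v.1 : nat) \in psums 0 k).
Proof.
rewrite inE; apply/existsP/andP => [[l /andP[/eqP h1 /eqP h2]]|[/eqP hl /psumsP[l]]].
  have := sumn_take_le l k; split; first by rewrite /lvl; lia.
  by apply/psumsP; exists l; rewrite // -ltnS.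
rewrite add0n -ltnS => lk h1; exists (Ordinal lk) => /=.
by move: hl; rewrite /lvl h1 eqxx; have := sumn_take_le l k; lia.
Qed.

Variable g : subgraph n.

Lemma gedge_step u v : gedge n k u v -> step u v.
Proof. by case/and3P. Qed.

Lemma pvertsP (p : n.-tuple (vert n)) v :
  reflect (exists p1 p2 : seq (vert n), tval p = p1 ++ p2 /\ v = last (origin n) p1)
    (v \in pverts n p).
Proof.
have -> : (v \in pverts n p) = (v \in origin n :: p) by rewrite !inE.
apply: (iffP idP) => [|[p1 [p2 [-> ->]]]].
  by case/splitPl=> p1 p2 <-; exists p1, p2.
by rewrite -cat_cons mem_cat mem_last.
Qed.

Lemma pedgesP (p : n.-tuple (vert n)) e :
  reflect (exists (p1 : seq (vert n)) v (p2 : seq (vert n)),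
             tval p = p1 ++ v :: p2 /\ e = (last (origin n) p1, v))
    (e \in pedges n p).
Proof. by rewrite inE; apply: mem_zip_split. Qed.

(** Each vertex and edge lies on a path of [S], where the level is the position; the neighbours on
    that path supply the incoming and outgoing edges. *)
Lemma isface_locface : isface n k g -> locface (psums 0 k) g.
Proof.
case/andP=> /subsetP hT /existsP[S /and3P[/forall_inP hS /eqP g1 /eqP g2]].
have pstep p : p \in S -> path (@step n) (origin n) p.
  by move=> /hS/andP[hp _]; apply: sub_path hp => u v /gedge_step.
have plvl (p : n.-tuple (vert n)) (p1 p2 : seq (vert n)) :
    p \in S -> tval p = p1 ++ p2 -> lvl (last (origin n) p1) = size p1.
  move=> /pstep hp ep; move: hp; rewrite ep cat_path => /andP[h _].
  by rewrite (step_path_lvl h) lvl_origin.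
have szp (p : n.-tuple (vert n)) (p1 p2 : seq (vert n)) :
    tval p = p1 ++ p2 -> size p1 + size p2 = n.
  by move=> ep; rewrite -size_cat -ep size_tuple.
have hV v : v \in g.1 -> exists p, [/\ p \in S & exists p1 p2 : seq (vert n),
    tval p = p1 ++ p2 /\ v = last (origin n) p1].
  by rewrite g1 => /bigcupP[p pS /pvertsP hp]; exists p.
have inV p (p1 p2 : seq (vert n)) : p \in S -> tval p = p1 ++ p2 -> last (origin n) p1 \in g.1.
  by move=> pS ep; rewrite g1; apply/bigcupP; exists p => //; apply/pvertsP; exists p1, p2.
have inE' p (p1 : seq (vert n)) v p2 :
    p \in S -> tval p = p1 ++ v :: p2 -> (last (origin n) p1, v) \in g.2.
  by move=> pS ep; rewrite g2; apply/bigcupP; exists p => //; apply/pedgesP; exists p1, v, p2.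
split.
(* The terminal [(0, n)] always exists, so [S] contains a path, and its empty prefix ends at the
   origin. *)
- have /hT/hV[p [pS _]] : ((ord0, ord_max) : vert n) \in terminals n k.
    by rewrite terminalsE /lvl add0n eqxx; apply/psumsP; exists 0; rewrite ?take0.
  exact: (inV p [::] p).
- move=> v /hV[p [pS [p1 [p2 [ep ->]]]]].
  by rewrite (plvl _ _ _ pS ep) (leq_trans (leq_addr (size p2) _)) ?(szp _ _ _ ep).
- move=> v vn; apply/idP/idP; last by move=> vT; apply: hT; rewrite terminalsE vn eqxx.
  case/hV=> p [pS [p1 [p2 [ep ev]]]].
  have sp1 : size p1 = n by rewrite -(plvl _ _ _ pS ep) -ev.
  have p20 : p2 = [::] by apply: size0nil; have := szp _ _ _ ep; lia.
  have /andP[_] := hS p pS; rewrite ep p20 cats0 -ev terminalsE.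
  by case/andP.
- move=> v /hV[p [pS [p1 [p2 [ep ->]]]]].
  rewrite (plvl _ _ _ pS ep); case: p2 ep => [/szp|w p2 ep _].
    by rewrite addn0 => ->; rewrite ltnn.
  by exists w; apply: inE' ep.
- move=> v /hV[p [pS [p1 [p2 [ep ->]]]]].
  rewrite (plvl _ _ _ pS ep); case/lastP: p1 ep => // p1 w.
  rewrite cat_rcons last_rcons => ep _; exists (last (origin n) p1).
  exact: inE' ep.
- move=> u v; rewrite g2 => /bigcupP[p pS /pedgesP[p1 [w [p2 [ep [-> ->]]]]]].
  split; first exact: inV ep.
    by rewrite -(last_rcons (origin n) p1 w); apply: (inV p _ p2); rewrite // cat_rcons.
  by move: (pstep p pS); rewrite ep cat_path /= => /and3P[].
Qed.

(** Outgoing edges lead up to a terminal, incoming edges down to the origin. Gluing two such walks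
    at any vertex or edge gives a positive path inside [g], so all positive paths with edges in [g]
    together cover [g]. *)
Lemma locface_isface : locface (psums 0 k) g -> isface n k g.
Proof.
move=> F.
pose e2 : rel (vert n) := fun u v => (u, v) \in g.2.
have e2s u v : e2 u v -> step u v by case/(lf_edge F).
(* The coordinate bounds place [v] below a terminal, which is what membership in [gvert] asks. *)
have fwd v : v \in g.1 -> exists q : seq (vert n), [/\ path e2 v q, size q = n - lvl v,
    last v q \in terminals n k, v.1 <= (last v q).1 & v.2 <= (last v q).2].
  move=> gv; have [d] := ubnP (n - lvl v); elim: d v gv => // d IH v gv hd.
  have := lf_lvl F gv; rewrite leq_eqVlt => /orP[/eqP vn|vn].
    by exists [::]; rewrite /= terminalsE vn eqxx -(lf_top F vn) subnn.
  have [w vw] := lf_out F gv vn; have [_ gw sw] := lf_edge F vw.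
  have hw := step_lvl sw.
  have [|q [pq sq tq q1 q2]] := IH w gw; first by lia.
  exists (w :: q); rewrite /= {1}/e2 vw pq sq hw; split=> //; first by lia.
    by apply: leq_trans q1; case: (step_le sw).
  by apply: leq_trans q2; case: (step_le sw).
have bwd v : v \in g.1 -> exists q : seq (vert n), [/\ path e2 (origin n) q, size q = lvl v &
    last (origin n) q = v].
  have [d] := ubnP (lvl v); elim: d v => // d IH v hd gv.
  have [/eqP v0|v0] := boolP (lvl v == 0).
    by exists [::]; rewrite v0 (lvl_eq0 v0).
  have [|u uv] := lf_in F gv; first by lia.
  have [gu _ /step_lvl hu] := lf_edge F uv.
  have [||q [pq sq lq]] := IH u => //; first by lia.
  exists (rcons q v); rewrite rcons_path size_rcons last_rcons pq lq sq hu.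
  by rewrite /= /e2 uv.
have gG v : v \in g.1 -> v \in gvert n k.
  case/fwd=> q [_ _ tq q1 q2]; rewrite inE; apply/existsP.
  by exists (last v q); rewrite tq q1 q2.
pose S := [set p : n.-tuple (vert n) | path e2 (origin n) p
             && (last (origin n) p \in terminals n k)].
have pV p v : p \in S -> v \in pverts n p -> v \in g.1.
  rewrite inE => /andP[hp _] /pvertsP[p1 [p2 [ep ->]]].
  move: hp; rewrite ep; case/lastP: p1 ep => [|p1 w] _; first by rewrite (lf_origin F).
  rewrite cat_path rcons_path last_rcons -andbA => /and3P[_ h _].
  by case: (lf_edge F h).
have pE p e : p \in S -> e \in pedges n p -> e \in g.2.
  rewrite inE => /andP[hp _] /pedgesP[p1 [w [p2 [ep ->]]]].
  by move: hp; rewrite ep cat_path /= => /and3P[].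
have mkp (p1 p2 : seq (vert n)) v : last (origin n) p1 = v -> path e2 (origin n) p1 ->
    path e2 v p2 -> last v p2 \in terminals n k -> size p1 + size p2 = n ->
    exists2 p, p \in S & tval p = p1 ++ p2.
  move=> lp1 hp1 hp2 tp2 sz.
  have szp : size (p1 ++ p2) == n by rewrite size_cat sz.
  by exists (Tuple szp); rewrite // inE /= cat_path last_cat lp1 hp1 hp2.
apply/andP; split.
  by apply/subsetP=> v; rewrite terminalsE => /andP[/eqP vn]; rewrite (lf_top F vn).
apply/existsP; exists S; apply/and3P; split.
- apply/forall_inP=> p pS; move: (pS); rewrite inE => /andP[hp tp]; apply/andP; split=> //.
  by apply: sub_path hp => u v /(lf_edge F)[/gG gu /gG gv suv]; rewrite /gedge gu gv.
- apply/eqP/setP=> v; apply/idP/bigcupP => [gv|[p pS]]; last exact: pV.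
  have [p1 [hp1 sp1 lp1]] := bwd v gv; have [p2 [hp2 sp2 tp2 _ _]] := fwd v gv.
  have [|p pS ep] := mkp p1 p2 v lp1 hp1 hp2 tp2.
    by have := lf_lvl F gv; lia.
  by exists p => //; apply/pvertsP; exists p1, p2.
- apply/eqP/setP=> -[u v]; apply/idP/bigcupP => [guv|[p pS]]; last exact: pE.
  have [gu gv /step_lvl hv] := lf_edge F guv.
  have [p1 [hp1 sp1 lp1]] := bwd u gu; have [p2 [hp2 sp2 tp2 _ _]] := fwd v gv.
  have [|||p pS ep] := mkp p1 (v :: p2) u lp1 hp1 => //=.
  + by rewrite {1}/e2 guv.
  + by have := lf_lvl F gv; lia.
  by exists p => //; apply/pedgesP; exists p1, v, p2; rewrite lp1.
Qed.

End IsFace.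

Lemma isfaceE k (g : subgraph (sumn k)) :
  isface (sumn k) k g = locfaceb (psums 0 k) g.
Proof.
by apply/idP/locfaceP; [apply: isface_locface|apply: locface_isface].
Qed.

(** * Connectedness and dimension *)

Section Dimension.
Variables (n : nat) (T : seq nat) (g : subgraph n).
Hypothesis F : locface T g.

Lemma adj_sym : symmetric (adj n g).
Proof. by move=> x y; rewrite /adj andbCA orbC. Qed.

(** Incoming edges lead from every vertex down to the origin, while [adj] never leaves [g.1]; hence
    [g.1] is the component of the origin. *)
Lemma locface_connected : n_comp (adj n g) (mem g.1) = 1.
Proof.
have csym : connect_sym (adj n g) by apply/sym_connect_sym/adj_sym.
rewrite -(n_comp_connect csym (origin n)); apply: eq_n_comp_r => v.
apply/idP/idP => [gv|].
  have [d] := ubnP (lvl v); elim: d v gv => // d IH v gv hd.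
  have [/eqP/lvl_eq0 ->|v0] := boolP (lvl v == 0); first exact: connect0.
  have [|u uv] := lf_in F gv; first by lia.
  have [gu _ /step_lvl hu] := lf_edge F uv.
  have cu : connect (adj n g) (origin n) u by apply: IH => //; lia.
  by apply: connect_trans cu (connect1 _); rewrite /adj gu gv uv.
case/connectP=> p; case/lastP: p => [_ ->|p w]; first exact: lf_origin F.
by rewrite rcons_path last_rcons => /andP[_ /and3P[]] + + _ ->.
Qed.

Lemma locface_fdim : fdim n g = #|g.2| + 1 - #|g.1|.
Proof. by rewrite /fdim locface_connected. Qed.

(** Every vertex but the origin is the head of some edge. The bound makes the truncated subtraction
    in the dimension exact. *)
Lemma locface_card : #|g.1| <= #|g.2| + 1.
Proof.
rewrite (cardsD1 (origin n)) (lf_origin F) addnC leq_add2r.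
apply: leq_trans (leq_imset_card snd (mem g.2)); apply/subset_leq_card/subsetP => v.
rewrite !inE => /andP[v0 gv].
have [|u uv] := lf_in F gv.
  by rewrite lt0n; apply: contra v0 => /eqP/lvl_eq0 ->.
by apply/imsetP; exists (u, v).
Qed.

End Dimension.

(** * Deleting the last antidiagonal *)

Definition locpoly n (T : seq nat) : {poly rat} :=
  (\sum_(g : subgraph n | locfaceb T g) 'X^(fdim n g))%R.

Lemma eq_locface n (T1 T2 : seq nat) (g : subgraph n) :
  T1 =i T2 -> locface T1 g -> locface T2 g.
Proof. by move=> eT [*]; split=> // v hv; rewrite -eT; auto. Qed.

Lemma eq_locpoly n (T1 T2 : seq nat) : T1 =i T2 -> locpoly n T1 = locpoly n T2.
Proof.
move=> eT; apply: eq_bigl => g.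
by apply/locfaceP/locfaceP; apply: eq_locface => // x; rewrite eT.
Qed.

Lemma facepolyE n k : n = sumn k -> facepoly n k = locpoly n (psums 0 k).
Proof. by move->; apply: eq_bigl => g; rewrite isfaceE. Qed.

Definition mkv n (i j : nat) : vert n := (inord i, inord j).

Lemma mkv1 n i j : i <= n -> ((mkv n i j).1 : nat) = i.
Proof. by move=> hi; rewrite inordK. Qed.

Lemma mkv2 n i j : j <= n -> ((mkv n i j).2 : nat) = j.
Proof. by move=> hj; rewrite inordK. Qed.

Lemma lvl_mkv n i j : i <= n -> j <= n -> lvl (mkv n i j) = i + j.
Proof. by move=> hi hj; rewrite /lvl mkv1 ?mkv2. Qed.

Definition wid n (v : vert n) : vert n.+1 :=
  (widen_ord (leqnSn n.+1) v.1, widen_ord (leqnSn n.+1) v.2).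

Lemma wid_inj n : injective (@wid n).
Proof. by move=> u v e; apply: vert_eqP; [case: e|case: e]. Qed.

Lemma lvl_wid n (v : vert n) : lvl (wid v) = lvl v.
Proof. by []. Qed.

Lemma wid_origin n : wid (origin n) = origin n.+1.
Proof. exact: vert_eqP. Qed.

Lemma lvl_le_wid n (x : vert n.+1) : lvl x <= n -> exists v, x = wid v.
Proof.
rewrite /lvl => hx; exists (mkv n x.1 x.2).
by apply: vert_eqP; rewrite /= inordK //; lia.
Qed.

(** * Edges into the last antidiagonal *)

Section TopEdges.
Variable n : nat.

Definition topv x := mkv n.+1 x (n.+1 - x).
(** Meaningful for [x <= n], while [tope_h] needs [0 < x]: at [x = n.+1], respectively [x = 0],
    truncated subtraction yields a loop. *)
Definition tope_v x := (mkv n.+1 x (n - x), topv x).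
Definition tope_h x := (mkv n.+1 x.-1 (n.+1 - x), topv x).

Lemma topv1 x : x <= n.+1 -> ((topv x).1 : nat) = x.
Proof. exact: mkv1. Qed.

Lemma topv2 x : ((topv x).2 : nat) = n.+1 - x.
Proof. by rewrite mkv2 // leq_subr. Qed.

Lemma topv_lvl x : x <= n.+1 -> lvl (topv x) = n.+1.
Proof. by move=> hx; rewrite /lvl topv1 // topv2 subnKC. Qed.

Lemma topv_eq (v : vert n.+1) : lvl v = n.+1 -> v = topv v.1.
Proof. by rewrite /lvl => hv; apply: vert_eqP; rewrite ?topv1 ?topv2 //; lia. Qed.

Lemma tope_vE x : x <= n -> (vstep (tope_v x).1 (tope_v x).2) /\
  forall u, vstep u (topv x) -> u = (tope_v x).1.
Proof.
move=> hx; split=> [|u]; rewrite /vstep /= topv1 ?topv2 ?leqW //.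
  by apply/andP; split; apply/eqP; rewrite ?inordK; lia.
by case/andP=> /eqP h1 /eqP h2; apply: vert_eqP; rewrite /= inordK; lia.
Qed.

Lemma tope_hE x : 0 < x -> x <= n.+1 -> (hstep (tope_h x).1 (tope_h x).2) /\
  forall u, hstep u (topv x) -> u = (tope_h x).1.
Proof.
move=> x0 hx; split=> [|u]; rewrite /hstep /= topv1 ?topv2 //.
  by apply/andP; split; apply/eqP; rewrite ?inordK; lia.
by case/andP=> /eqP h1 /eqP h2; apply: vert_eqP; rewrite /= inordK; lia.
Qed.

Lemma tope_v_hstep x : x <= n -> hstep (tope_v x).1 (tope_v x).2 = false.
Proof. by move=> hx; apply/negP=> /andP[/eqP /=]; rewrite !inordK; lia. Qed.

Lemma tope_h_vstep x : 0 < x -> x <= n.+1 ->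
  vstep (tope_h x).1 (tope_h x).2 = false.
Proof. by move=> x0 hx; apply/negP=> /andP[/eqP /=]; rewrite !inordK; lia. Qed.

Lemma vstep_top (x y : vert n.+1) : lvl y = n.+1 -> vstep x y ->
  (y.1 : nat) <= n /\ (x, y) = tope_v y.1.
Proof.
move=> hy xy; have hy1 : y.1 <= n.
  by move: hy xy; rewrite /lvl /vstep => hy /andP[_ /eqP h]; lia.
have [_ h] := tope_vE hy1; split=> //.
by rewrite (h x) -?topv_eq // {2}(topv_eq hy).
Qed.

Lemma hstep_top (x y : vert n.+1) : lvl y = n.+1 -> hstep x y ->
  0 < y.1 /\ (x, y) = tope_h y.1.
Proof.
move=> hy xy; have hy0 : 0 < y.1 by case/andP: xy => /eqP ->.
have hy1 : y.1 <= n.+1 by rewrite -ltnS.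
have [_ h] := tope_hE hy0 hy1; split=> //.
by rewrite (h x) -?topv_eq // {2}(topv_eq hy).
Qed.

End TopEdges.

(** * Removing and restoring the top layer *)

Section Layer.
Variables (n : nat) (V H : seq nat).
Hypothesis Vle : forall x, x \in V -> x <= n.
Hypothesis Hgt0 : forall x, x \in H -> 0 < x.
Hypothesis Hle : forall x, x \in H -> x <= n.+1.

(* The edges into the last antidiagonal, [V] and [H] listing the first
   coordinates of the heads of the vertical and horizontal ones. *)
Definition topE : {set vert n.+1 * vert n.+1} :=
  [set e | (lvl e.2 == n.+1) &&
     ((vstep e.1 e.2 && ((e.2.1 : nat) \in V)) ||
      (hstep e.1 e.2 && ((e.2.1 : nat) \in H)))].

Definition hasTop (g : subgraph n.+1) : bool :=
  [set e in g.2 | lvl e.2 == n.+1] == topE.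

(** Levels are tested explicitly because the square [vert n] can also contain vertices of level
    [n.+1], which must go. *)
Definition peel (g : subgraph n.+1) : subgraph n :=
  ([set v | (lvl v <= n) && (wid v \in g.1)],
   [set e | (lvl e.2 <= n) && ((wid e.1, wid e.2) \in g.2)]).

Definition wide (e : vert n * vert n) := (wid e.1, wid e.2).

Lemma wide_inj : injective wide.
Proof.
move=> [a b] [c d] e; congr (_, _); apply: wid_inj.
  exact: (congr1 (@fst (vert n.+1) (vert n.+1)) e).
exact: (congr1 (@snd (vert n.+1) (vert n.+1)) e).
Qed.

Definition topV : {set vert n.+1} :=
  [set v | (lvl v == n.+1) && ((v.1 : nat) \in V ++ H)].

Definition unpeel (g : subgraph n) : subgraph n.+1 :=
  (@wid n @: g.1 :|: topV, wide @: g.2 :|: topE).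

(** First coordinates of the tails of the prescribed edges: a vertical edge keeps the coordinate of
    its head, a horizontal one starts one column earlier. The tails become the new terminals. *)
Let T' := V ++ map predn H.

Lemma topE_lvl x y : (x, y) \in topE -> [/\ lvl y = n.+1, lvl x = n & step x y].
Proof.
rewrite inE /= => /andP[/eqP hy h].
have sxy : step x y by rewrite /step; case/orP: h => /andP[-> //]; rewrite orbT.
by split=> //; move: (step_lvl sxy); rewrite hy => -[].
Qed.

Lemma topE_out (v : vert n) : lvl v = n -> (v.1 : nat) \in T' ->
  exists y, (wid v, y) \in topE.
Proof.
move=> vn; rewrite /lvl in vn.
rewrite mem_cat => /orP[vV|/mapP[x xH ex]].
  exists (mkv n.+1 v.1 v.2.+1).
  rewrite inE /= lvl_mkv; [|lia|lia].
  by rewrite /vstep mkv1 ?mkv2 /=; [|lia|lia]; rewrite vV !eqxx /= addnS vn eqxx.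
have x0 := Hgt0 xH; have xv : x = v.1.+1 by lia.
exists (mkv n.+1 v.1.+1 v.2).
rewrite inE /= lvl_mkv; [|lia|lia].
rewrite /hstep mkv1 ?mkv2 /=; [|lia|lia]; rewrite -xv xH !eqxx /= xv addSn vn eqxx.
by rewrite orbT.
Qed.

Lemma topE_in (y : vert n.+1) : lvl y = n.+1 -> (y.1 : nat) \in V ++ H ->
  exists x, (x, y) \in topE.
Proof.
move=> yn; have yn' := yn; rewrite /lvl in yn'.
rewrite mem_cat => /orP[yV|yH].
  have y1 := Vle yV; exists (mkv n.+1 y.1 y.2.-1).
  by rewrite inE /= yn eqxx yV /vstep mkv1 ?mkv2; lia.
have y1 := Hgt0 yH; exists (mkv n.+1 y.1.-1 y.2).
by rewrite inE /= yn eqxx yH /hstep mkv1 ?mkv2; lia.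
Qed.

Lemma topE_src x y : (wid x, y) \in topE -> (x.1 : nat) \in T'.
Proof.
rewrite inE mem_cat /= => /andP[_ /orP[|]] /andP[/andP[/eqP e1 _]]; rewrite e1 /=.
  by move->.
by move=> xH; apply/orP; right; apply/mapP; exists x.1.+1.
Qed.

Lemma topE_tgt x y : (x, y) \in topE -> y \in topV.
Proof.
rewrite !inE /= mem_cat => /andP[-> /orP[]] /andP[_ ->] //=.
by rewrite orbT.
Qed.

Section Unpeel.
Variable g : subgraph n.
Hypothesis F : locface T' g.

Lemma unpeel1_wid v : lvl v <= n -> (wid v \in (unpeel g).1) = (v \in g.1).
Proof.
move=> vn; rewrite in_setU inE lvl_wid.
rewrite (_ : (lvl v == n.+1) = false) ?orbF; last by lia.
by rewrite mem_imset //; apply: wid_inj.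
Qed.

Lemma unpeel1_top x : n < lvl x -> (x \in (unpeel g).1) = (x \in topV).
Proof.
move=> xn; rewrite in_setU orb_idl // => /imsetP[v gv ex].
by move: xn; rewrite ex lvl_wid ltnNge (lf_lvl F gv).
Qed.

Lemma unpeel2_wid u v : lvl v <= n ->
  ((wid u, wid v) \in (unpeel g).2) = ((u, v) \in g.2).
Proof.
move=> vn; rewrite in_setU orbC.
have -> /= : ((wid u, wid v) \in topE) = false.
  by apply/negP=> /topE_lvl[]; rewrite lvl_wid; lia.
by rewrite (mem_imset _ (u, v) wide_inj).
Qed.

Lemma unpeel2_top x y : n < lvl y -> ((x, y) \in (unpeel g).2) = ((x, y) \in topE).
Proof.
move=> yn; rewrite in_setU orb_idl // => /imsetP[[u v] guv [_ ey]].
have [_ gv _] := lf_edge F guv.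
by move: yn; rewrite ey lvl_wid ltnNge (lf_lvl F gv).
Qed.

(** Below level [n] nothing changes. A vertex of level [n] has its coordinate in [T'], hence starts
    a prescribed edge, and each vertex of [topV] receives one. *)
Lemma unpeel_locface : locface (V ++ H) (unpeel g).
Proof.
split.
- by rewrite -wid_origin unpeel1_wid ?(lf_origin F).
- move=> x; have [xn _|xn] := leqP (lvl x) n; first exact: leqW.
  by rewrite unpeel1_top // inE => /andP[/eqP ->].
- by move=> x xn; rewrite unpeel1_top ?inE ?xn ?eqxx.
- move=> x + xn; have [v ev] := lvl_le_wid xn; rewrite ev lvl_wid ltnS in xn *.
  rewrite unpeel1_wid // => gv.
  move: xn; rewrite leq_eqVlt => /orP[/eqP vn|vn].
    have [|y hy] := @topE_out v vn; first by rewrite -(lf_top F vn).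
    by exists y; rewrite in_setU hy orbT.
  have [w gw] := lf_out F gv vn; exists (wid w).
  have [_ gw' _] := lf_edge F gw.
  rewrite unpeel2_wid //.
  exact: (lf_lvl F gw').
- move=> y; have [yn|yn] := leqP (lvl y) n.
    have [v ev] := lvl_le_wid yn; rewrite ev lvl_wid in yn *.
    rewrite unpeel1_wid // => gv /(lf_in F gv)[u uv].
    by exists (wid u); rewrite unpeel2_wid.
  rewrite unpeel1_top // inE => /andP[/eqP hy hT] _.
  by have [x xy] := topE_in hy hT; exists x; rewrite unpeel2_top.
- move=> x y; have [yn|yn] := leqP (lvl y) n.
    rewrite in_setU => /orP[/imsetP[[u v] guv [-> ->]]|/topE_lvl[]]; last by lia.
    have [gu gv suv] := lf_edge F guv.
    by rewrite !unpeel1_wid // ?(lf_lvl F).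
  rewrite unpeel2_top // => xy; have [hy hx sxy] := topE_lvl xy.
  have [|v ev] := @lvl_le_wid _ x; first by rewrite hx.
  rewrite ev lvl_wid in hx xy sxy *.
  split=> //; last by rewrite unpeel1_top // (topE_tgt xy).
  by rewrite unpeel1_wid ?hx // (lf_top F hx) (topE_src xy).
Qed.

Lemma unpeel_hasTop : hasTop (unpeel g).
Proof.
apply/eqP/setP=> -[x y]; rewrite inE /=.
have [yn|yn] := eqVneq (lvl y) n.+1; last first.
  by rewrite andbF; apply/esym/negP=> /topE_lvl[]/eqP; rewrite (negPf yn).
by rewrite andbT unpeel2_top // yn.
Qed.

Lemma unpeelK : peel (unpeel g) = g.
Proof.
rewrite [RHS]surjective_pairing /peel; congr (_, _); apply/setP.
  move=> v; rewrite [LHS]inE; have [vn|vn] := leqP (lvl v) n; first exact: unpeel1_wid.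
  by apply/esym/negP=> /(lf_lvl F); rewrite leqNgt vn.
move=> [u v]; rewrite [LHS]inE; have [vn|vn] := leqP (lvl v) n; first exact: unpeel2_wid.
by apply/esym/negP=> /(lf_edge F)[_ /(lf_lvl F)]; rewrite leqNgt vn.
Qed.

End Unpeel.

Section Peel.
Variable g : subgraph n.+1.
Hypothesis F : locface (V ++ H) g.
Hypothesis C : hasTop g.

Lemma top_edges x y : lvl y = n.+1 -> ((x, y) \in g.2) = ((x, y) \in topE).
Proof. by move=> hy; rewrite -(eqP C) [RHS]inE hy eqxx andbT. Qed.

Lemma topE_sub x y : (x, y) \in topE -> (x, y) \in g.2.
Proof. by move=> h; rewrite top_edges //; case: (topE_lvl h). Qed.

(** A vertex of level [n] has an outgoing edge, which by [C] is a prescribed one; so the vertices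
    left at level [n] are exactly the tails recorded in [T']. *)
Lemma peel_locface : locface T' (peel g).
Proof.
split.
- by rewrite inE wid_origin (lf_origin F).
- by move=> v; rewrite inE => /andP[].
- move=> v vn; rewrite inE vn leqnn /=; apply/idP/idP => [gv|vT].
    have [|w vw] := lf_out F gv; first by rewrite lvl_wid vn.
    have [_ _ /step_lvl] := lf_edge F vw; rewrite lvl_wid vn => wn.
    by rewrite top_edges // in vw; apply: topE_src vw.
  by have [y /topE_sub/(lf_edge F)[]] := topE_out vn vT.
- move=> v; rewrite inE => /andP[vn gv] vn'.
  have [|w vw] := lf_out F gv; first by rewrite lvl_wid ltnS.
  have [_ _ /step_lvl] := lf_edge F vw; rewrite lvl_wid => wn.
  have [|w' ew] := @lvl_le_wid _ w; first by rewrite wn.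
  by exists w'; rewrite inE /= -ew vw -(lvl_wid w') -ew wn vn'.
- move=> v; rewrite inE => /andP[vn gv] v0.
  have [|u uv] := lf_in F gv; first by rewrite lvl_wid.
  have [_ _ /step_lvl] := lf_edge F uv; rewrite lvl_wid => wn.
  have [|u' eu] := @lvl_le_wid _ u; first by lia.
  by exists u'; rewrite inE /= vn -eu.
- move=> u v; rewrite inE /= => /andP[vn /(lf_edge F)[gu gv suv]].
  rewrite !inE gu gv vn !andbT; split=> //.
  by have := step_lvl suv; rewrite !lvl_wid; lia.
Qed.

(** What [peel] forgets is determined: [F] fixes the vertices of level [n.+1], and [C] the edges
    into them. *)
Lemma peelK : unpeel (peel g) = g.
Proof.
have F' := peel_locface.
rewrite [RHS]surjective_pairing [LHS]surjective_pairing; congr (_, _); apply/setP.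
  move=> x; have [xn|xn] := leqP (lvl x) n.
    have [v ev] := lvl_le_wid xn; rewrite ev lvl_wid in xn *.
    by rewrite unpeel1_wid // inE xn.
  rewrite unpeel1_top // inE; have [xn'|xn'] := eqVneq (lvl x) n.+1.
    by rewrite (lf_top F xn').
  by apply/esym/negP=> /(lf_lvl F); lia.
move=> [x y]; have [yn|yn] := leqP (lvl y) n.
  have [v ev] := lvl_le_wid yn; rewrite ev lvl_wid in yn *.
  have [xn|xn] := leqP (lvl x) n.
    by have [u ->] := lvl_le_wid xn; rewrite unpeel2_wid // inE yn.
  transitivity false; last first.
    by apply/esym/negP=> /(lf_edge F)[_ _ /step_lvl]; rewrite lvl_wid; lia.
  by apply/negP=> /(lf_edge (unpeel_locface F'))[_ _ /step_lvl]; rewrite lvl_wid; lia.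
rewrite unpeel2_top //; have [yn'|yn'] := eqVneq (lvl y) n.+1.
  by rewrite top_edges.
transitivity false; first by apply/negP=> /topE_lvl[]; lia.
by apply/esym/negP=> /(lf_edge F)[_ /(lf_lvl F)]; lia.
Qed.

End Peel.

Section Cards.
Hypotheses (uV : uniq V) (uH : uniq H).

Lemma card_topE : #|topE| = size V + size H.
Proof.
have tin x y : x <= n.+1 -> y <= n.+1 -> topv n x = topv n y -> x = y.
  by move=> hx hy e; rewrite -(topv1 hx) e topv1.
rewrite -(size_map (tope_v n) V) -(size_map (tope_h n) H) -size_cat.
rewrite -(card_uniqP _); last first.
  rewrite cat_uniq !map_inj_in_uniq ?uV ?uH ?andbT /=.
  (* A common edge has a single head, forcing [x = y], yet its tail would have first coordinate both
     [x.-1] and [x], with [x] positive. *)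
  - apply/hasPn=> e /mapP[x xH ->]; apply/mapP=> -[y yV e'].
    have hx := Hle xH; have hx0 := Hgt0 xH; have hy := Vle yV.
    have exy : x = y by apply: tin => //; [lia|
      exact: (congr1 (@snd (vert n.+1) (vert n.+1)) e')].
    have := congr1 (fun e : vert n.+1 * vert n.+1 => (e.1.1 : nat)) e'.
    by rewrite /= !inordK; lia.
  - move=> x y xH yH e; apply: tin; [exact: Hle|exact: Hle|
      exact: (congr1 (@snd (vert n.+1) (vert n.+1)) e)].
  - move=> x y xV yV e; apply: tin; [exact/leqW/Vle|exact/leqW/Vle|
      exact: (congr1 (@snd (vert n.+1) (vert n.+1)) e)].
apply: eq_card => -[u v]; rewrite inE mem_cat /=; apply/andP/orP.
  case=> /eqP hv /orP[]/andP[huv hin]; [left|right]; apply/mapP; exists (v.1 : nat) => //.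
    have [_ h] := tope_vE (Vle hin).
    by rewrite (h u) -?topv_eq // {2}(topv_eq hv).
  have [_ h] := tope_hE (Hgt0 hin) (Hle hin).
  by rewrite (h u) -?topv_eq // {2}(topv_eq hv).
case=> /mapP[x xin [-> ->]].
  have hx := Vle xin; have [h _] := tope_vE hx.
  by rewrite topv_lvl ?leqW // eqxx topv1 ?leqW // xin h.
have hx := Hle xin; have [h _] := tope_hE (Hgt0 xin) hx.
by rewrite topv_lvl // eqxx topv1 // xin h orbT.
Qed.

Lemma card_topV (T : seq nat) : uniq T -> T =i V ++ H -> #|topV| = size T.
Proof.
move=> uT eT; have Tle x : x \in T -> x <= n.+1.
  by rewrite eT mem_cat => /orP[/Vle/leqW|/Hle].
rewrite -(size_map (topv n) T) -(card_uniqP _); last first.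
  rewrite map_inj_in_uniq // => x y xT yT e.
  by rewrite -(topv1 (Tle x xT)) e topv1 ?Tle.
apply: eq_card => v; rewrite inE -eT; apply/andP/mapP => [[/eqP hv vT]|[x xT ->]].
  by exists (v.1 : nat) => //; apply: topv_eq.
by rewrite topv_lvl ?topv1 ?Tle ?eqxx.
Qed.

Lemma unpeel_fdim (T : seq nat) (g : subgraph n) : uniq T -> T =i V ++ H ->
  locface T' g -> fdim n.+1 (unpeel g) = fdim n g + (size V + size H - size T).
Proof.
move=> uT eT F; rewrite (locface_fdim F) (locface_fdim (unpeel_locface F)).
have -> : #|(unpeel g).1| = #|g.1| + size T.
  rewrite -(card_topV uT eT) -(card_imset _ (@wid_inj n)); apply/eqP.
  rewrite (leq_card_setU _ _).2 disjoints_subset; apply/subsetP=> x /imsetP[v gv ->].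
  by rewrite !inE lvl_wid; have := lf_lvl F gv; lia.
have -> : #|(unpeel g).2| = #|g.2| + (size V + size H).
  rewrite -card_topE -(card_imset _ wide_inj); apply/eqP.
  rewrite (leq_card_setU _ _).2 disjoints_subset; apply/subsetP=> x /imsetP[[u v] guv ->].
  have [_ /(lf_lvl F) vn _] := lf_edge F guv.
  by rewrite inE; apply/negP=> /topE_lvl[/=]; rewrite lvl_wid /=; lia.
(* This bound and the next make all the truncated subtractions exact. *)
have := locface_card F.
have : size T <= size V + size H.
  by rewrite -size_cat; apply: uniq_leq_size => // x; rewrite eT.
lia.
Qed.

End Cards.

(** [peel] and [unpeel] are inverse bijections between the faces with the prescribed top edges and
    the faces one size smaller, and they change the dimension by a constant. *)
Lemma layer_sum (T : seq nat) : uniq V -> uniq H -> uniq T -> T =i V ++ H ->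
  (\sum_(g : subgraph n.+1 | locfaceb T g && hasTop g) 'X^(fdim n.+1 g))%R
    = ('X^(size V + size H - size T) * locpoly n T')%R :> {poly rat}.
Proof.
move=> uV uH uT eT; rewrite /locpoly big_distrr /=.
have hT g : reflect (locface (V ++ H) g) (locfaceb (n:=n.+1) T g).
  by apply: (iffP (locfaceP _ _)); apply: eq_locface => // x; rewrite eT.
rewrite (reindex_onto unpeel peel); last first.
  by move=> g /andP[/hT F C]; apply: peelK.
rewrite [LHS]big_mkcond [RHS]big_mkcond /=; apply: eq_bigr => g _.
case: (locfaceP T' g) => [F|nF].
  rewrite (introT (hT _) (unpeel_locface F)) unpeel_hasTop // unpeelK // eqxx /=.
  by rewrite (unpeel_fdim uV uH uT eT F) exprD mulrC.
(* Here [g] is not a local face; if it were the peeling of the face [unpeel g], [peel_locface] would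
   make it one. So both terms vanish. *)
case: ifP => // /andP[/andP[/hT F C] /eqP e]; case: nF; rewrite -e.
exact: peel_locface.
Qed.

(** All edges of a local face are vertical or horizontal steps, so equality of edge sets reduces to
    testing two candidate edges at each [x]. *)
Lemma hasTopP T (g : subgraph n.+1) : locface T g ->
  reflect ((forall x, x <= n -> (tope_v n x \in g.2) = (x \in V)) /\
           (forall x, 0 < x -> x <= n.+1 -> (tope_h n x \in g.2) = (x \in H)))
          (hasTop g).
Proof.
move=> F; apply: (iffP idP) => [C|[hV hH]].
  split=> x.
    move=> xn; have xn' := leqW xn.
    rewrite top_edges ?topv_lvl // inE /= topv_lvl // eqxx topv1 //=.
    by have [-> _] := tope_vE xn; rewrite tope_v_hstep // orbF.
  move=> x0 xn; rewrite top_edges ?topv_lvl // inE /= topv_lvl // eqxx topv1 //=.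
  by have [-> _] := tope_hE x0 xn; rewrite tope_h_vstep.
apply/eqP/setP=> -[x y]; rewrite !inE /= andbC; case: eqP => //= hy.
apply/idP/orP => [gxy|].
  have [_ _ /orP[]] := lf_edge F gxy => sxy; [left|right]; rewrite sxy /=.
    have [hy1 e] := vstep_top hy sxy; by rewrite -hV // -e.
  have [hy1 e] := hstep_top hy sxy; by rewrite -hH // -?e // -ltnS.
case=> /andP[sxy hin].
  have [hy1 e] := vstep_top hy sxy; by rewrite e hV.
have [hy1 e] := hstep_top hy sxy; by rewrite e hH // -ltnS.
Qed.

End Layer.

(** * Derivatives as shifts *)

(* [(v, h)] tells whether the vertical and the horizontal edge into an inner
   terminal are present; at least one of them is. *)
Definition letters : seq (bool * bool) := [:: (true, false); (false, true); (true, true)].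

Fixpoint words (m : nat) : seq (seq (bool * bool)) :=
  if m is m'.+1 then [seq x :: c | x <- letters, c <- words m'] else [:: [::]].

Definition nboth (c : seq (bool * bool)) : nat := count (fun x => x.1 && x.2) c.

(* The parts, zeros included, of the ladder diagram left after deleting the
   terminals of the diagram with parts [map S (a0 :: a)]. *)
Fixpoint refine (a0 : nat) (a : seq nat) (c : seq (bool * bool)) : seq nat :=
  match a, c with
  | a1 :: a', (v, h) :: c' =>
      a0 + (v && ~~ h) :: nat_of_bool (v && h) :: refine (a1 + (h && ~~ v)) a' c'
  | _, _ => [:: a0]
  end.

(* The exponents of x * y when x has exponents [a0 :: a] and y has exponents 0. *)
Fixpoint spread (a0 : nat) (a : seq nat) : seq nat :=
  a0 :: (if a is a1 :: a' then 0 :: spread a1 a' else [::]).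

Section Algebra.
Local Open Scope ring_scope.

(** [G] takes lists, so that differentiation becomes incrementing a list entry; [Psi] is the case of
    [Fpoly]. *)
Definition egf m (G : seq nat -> {poly rat}) : fps m := fun e =>
  ((\prod_(i < m) (e i)`!)%:R)^-1 *: G [seq e i | i <- enum 'I_m].

Lemma nth_map_enum m (f : 'I_m -> nat) j (jm : (j < m)%N) :
  nth 0%N [seq f i | i <- enum 'I_m] j = f (Ordinal jm).
Proof.
have sz : (j < size (enum 'I_m))%N by rewrite size_enum_ord.
rewrite (nth_map (Ordinal jm) _ _ sz); congr f.
by apply: val_inj; rewrite /= nth_enum_ord.
Qed.

Lemma map_incr m (e : {ffun 'I_m -> nat}) i : (i < m)%N ->
  [seq incr m e i j | j <- enum 'I_m] = incr_nth [seq e j | j <- enum 'I_m] i.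
Proof.
move=> im; apply: (@eq_from_nth _ 0%N) => [|j].
  by rewrite size_incr_nth 2!size_map size_enum_ord im.
rewrite size_map size_enum_ord => jm; rewrite nth_incr_nth.
by rewrite !(nth_map_enum _ jm) /incr ffunE addnC eq_sym.
Qed.

(** The factor [(expo m e i).+1] cancels against the factorial of the incremented exponent. *)
Lemma pd_egf m (f : fps m) G i : (i < m)%N -> f =1 egf G ->
  pd m i f =1 egf (fun s => G (incr_nth s i)).
Proof.
move=> im fG e; rewrite /pd fG /egf map_incr // scalerA; congr (_ *: _).
have -> : expo m e i = e (Ordinal im) by rewrite /expo insubT.
rewrite (bigD1 (Ordinal im)) //= [in RHS](bigD1 (Ordinal im)) //=.
rewrite (_ : \prod_(j < m | j != Ordinal im) (incr m e i j)`! =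
  \prod_(j < m | j != Ordinal im) (e j)`!)%N; last first.
  apply: eq_bigr => j; rewrite /incr ffunE -val_eqE /= => /negPf ->; by rewrite addn0.
rewrite /incr ffunE eqxx addn1 factS -mulnA [in LHS]natrM invfM mulrA mulfV ?mul1r //.
by rewrite Num.Theory.pnatr_eq0.
Qed.

Lemma foldr_egf m (I : eqType) (D : I -> fps m -> fps m)
    (E : I -> (seq nat -> {poly rat}) -> seq nat -> {poly rat}) (l : seq I) f G :
    (forall i f G, i \in l -> f =1 egf G -> D i f =1 egf (E i G)) -> f =1 egf G ->
  foldr D f l =1 egf (foldr E G l).
Proof.
elim: l => //= i l IH h fG; apply: (h i); first by rewrite inE eqxx.
by apply: IH => // j f' G' jl; apply: h; rewrite inE jl orbT.
Qed.

Definition shiftx (j : nat) (G : seq nat -> {poly rat}) s := G (incr_nth s j.*2).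

Definition shiftxy (i : nat) (G : seq nat -> {poly rat}) s :=
  G (incr_nth s i.*2) + G (incr_nth s i.*2.+2) + 'X * G (incr_nth s i.*2.+1).

Lemma dmixed_egf s G : dmixed s (egf G) =1 egf (foldr shiftx G (iota 0 s)).
Proof.
apply: foldr_egf => // i f G' hi fG; apply: pd_egf fG.
by move: hi; rewrite mem_iota; lia.
Qed.

Lemma dprod_egf s G : dprod s (egf G) =1 egf (foldr shiftxy G (iota 0 s.-1)).
Proof.
apply: foldr_egf => // i f G' hi fG e.
have hs : (i < s.-1)%N by move: hi; rewrite mem_iota.
rewrite /fadd /tmul !(pd_egf _ fG); try by lia.
by rewrite /egf /shiftxy !scalerDr scalerAr.
Qed.

(** Dropping two leading entries lowers positions by two, hence the operator number by one. *)
Lemma foldr_shiftxy_cons G x y t l :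
  foldr shiftxy G (map S l) (x :: y :: t)
    = foldr shiftxy (fun t => G (x :: y :: t)) l t.
Proof. by elim: l t => //= i l IH t; rewrite /shiftxy doubleS /= !IH. Qed.

Lemma foldr_shiftx_cons G x y t l :
  foldr shiftx G (map S l) (x :: y :: t)
    = foldr shiftx (fun t => G (x :: y :: t)) l t.
Proof. by elim: l t => //= i l IH t; rewrite /shiftx doubleS /= IH. Qed.

(** Expanding the product picks one summand per factor. Listed as in [letters], the summands raise
    the left part, the right part or the zero between them, just as [refine] does, and ['X] marks
    the letter with both edges. *)
Lemma foldr_shiftxy_spread G a0 a :
  foldr shiftxy G (iota 0 (size a)) (spread a0 a)
    = \sum_(c <- words (size a)) 'X^(nboth c) * G (refine a0 a c).
Proof.
elim: a a0 G => [|a1 a IH] a0 G.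
  by rewrite big_seq1 mul1r.
rewrite [size _]/= [iota _ _]/= [foldr _ _ _]/= (iotaDl 1 0) {1}/shiftxy /=.
have incr_spread : incr_nth (spread a1 a) 0 = spread a1.+1 a by case: (a).
rewrite incr_spread !foldr_shiftxy_cons !IH !big_cat !big_map big_nil !Monoid.simpm /=.
congr (_ + _ + _).
- by apply: eq_bigr => c _; rewrite addn1.
- by apply: eq_bigr => c _; rewrite addn1.
- by rewrite big_distrr; apply: eq_bigr => c _; rewrite /= mulrA -exprS.
Qed.

(** One derivative in each x-variable makes all parts positive, the form to which the recursion
    applies. *)
Lemma foldr_shiftx_spread G a0 a :
  foldr shiftx G (iota 0 (size a).+1) (spread a0 a) = G (spread a0.+1 (map S a)).
Proof.
elim: a a0 G => [|a1 a IH] a0 G //.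
have -> : iota 0 (size (a1 :: a)).+1 = 0%N :: map S (iota 0 (size a).+1).
  by rewrite -(iotaDl 1 0).
rewrite -[LHS]/(foldr shiftx G (map S (iota 0 (size a).+1)) [:: a0.+1, 0%N & spread a1 a]).
by rewrite foldr_shiftx_cons IH.
Qed.

Lemma nth_spread a0 a j :
  nth 0%N (spread a0 a) j = if odd j then 0%N else nth 0%N (a0 :: a) j./2.
Proof.
elim: a a0 j => [|a1 a IH] a0 [|[|j]] //=.
  by rewrite !nth_nil if_same.
by rewrite IH negbK.
Qed.

Lemma size_spread a0 a : size (spread a0 a) = (size a).*2.+1.
Proof. by elim: a a0 => //= a1 a IH a0; rewrite IH. Qed.

Lemma map_ystar s (a : {ffun 'I_s -> nat}) a0 a' :
  [seq a i | i <- enum 'I_s] = a0 :: a' ->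
  [seq ystar s a j | j <- enum 'I_(s.*2.-1)] = spread a0 a'.
Proof.
move=> ea; have sz : s = (size a').+1.
  by rewrite -(size_enum_ord s) -(size_map a) ea.
apply: (@eq_from_nth _ 0%N) => [|j].
  by rewrite size_map size_enum_ord size_spread sz.
rewrite size_map size_enum_ord => js; rewrite nth_spread.
rewrite (nth_map_enum _ js) /ystar ffunE /=.
case: ifP => // oj; rewrite -ea.
have js' : (j./2 < s)%N by lia.
by rewrite (nth_map_enum _ js') /expo insubT.
Qed.

End Algebra.

(** * The recursion for the f-polynomial *)

Lemma lettersP x : x \in letters ->
  [\/ x = (true, false), x = (false, true) | x = (true, true)].
Proof. by case: x => -[] []; constructor. Qed.

Lemma mem_words m c : (c \in words m) = (size c == m) && all (mem letters) c.
Proof.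
elim: m c => [|m IH] c; first by case: c.
have -> : words m.+1 = allpairs cons letters (words m) by [].
case: c => [|x c]; first by apply/negbTE/allpairsP=> -[[y d] [_ _]].
rewrite [RHS]/= eqSS andbCA -IH.
apply/allpairsP/andP => [[[y d] [/= yl dm [-> ->]]]|[xl cm]] //.
by exists (x, c).
Qed.

Lemma words_uniq m : uniq (words m).
Proof.
elim: m => // m IH; rewrite (_ : words _ = allpairs cons letters (words m)) //.
apply: allpairs_uniq => //.
by move=> [x c] [y d] _ _ [-> ->].
Qed.

Lemma filter_spread a0 a :
  [seq x <- spread a0.+1 (map S a) | 0 < x] = a0.+1 :: map S a.
Proof. by elim: a a0 => //= a1 a IH a0; rewrite -IH. Qed.

Lemma Fpoly_spread a0 a : Fpoly (spread a0.+1 (map S a)) = Fpoly (a0.+1 :: map S a).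
Proof.
rewrite /Fpoly filter_spread (_ : filter _ (_ :: _) = a0.+1 :: map S a) //.
by apply/all_filterP; rewrite /= all_map; apply/allP.
Qed.

Lemma sumn_filter_gt0 k : sumn [seq x <- k | 0 < x] = sumn k.
Proof. by elim: k => //= -[|x] k IH /=; rewrite IH. Qed.

Lemma psums_filter_gt0 b k : psums b [seq x <- k | 0 < x] =i psums b k.
Proof.
elim: k b => [//|[|x] k IH] b y /=.
  rewrite IH addn0 inE orb_idl // => /eqP ->.
  by apply/psumsP; exists 0; rewrite // take0 addn0.
by rewrite !inE IH.
Qed.

Lemma FpolyE k : Fpoly k = locpoly (sumn k) (psums 0 k).
Proof.
rewrite /Fpoly facepolyE // sumn_filter_gt0; apply: eq_locpoly => x.
exact: psums_filter_gt0.
Qed.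

(** First coordinates, offset by [b], of the inner terminals for the parts [a0.+1 :: map S a]. *)
Fixpoint cuts (b a0 : nat) (a : seq nat) : seq nat :=
  if a is a1 :: a' then (b + a0.+1) :: cuts (b + a0.+1) a1 a' else [::].

Lemma size_cuts b a0 a : size (cuts b a0 a) = size a.
Proof. by elim: a b a0 => //= a1 a IH b a0; rewrite IH. Qed.

Lemma psums_cuts b a0 a :
  psums b (a0.+1 :: map S a) = b :: rcons (cuts b a0 a) (b + sumn (a0.+1 :: map S a)).
Proof.
elim: a b a0 => [|a1 a IH] b a0; first by rewrite /= addn0.
rewrite [cuts _ _ _]/= [map _ _]/= rcons_cons.
rewrite -[LHS]/(b :: psums (b + a0.+1) (a1.+1 :: map S a)).
by rewrite IH /= !addnA.
Qed.

Lemma path_cuts b a0 a :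
  path ltn b (rcons (cuts b a0 a) (b + sumn (a0.+1 :: map S a))).
Proof.
elim: a b a0 => [|a1 a IH] b a0; first by rewrite /=; lia.
rewrite [cuts _ _ _]/= [map _ _]/= rcons_cons [path _ _ _]/=.
have := IH (b + a0.+1) a1; rewrite /= !addnA => ->.
by rewrite andbT /ltn /=; lia.
Qed.

Lemma sumn_refine a0 a c : size c = size a -> all (mem letters) c ->
  sumn (refine a0 a c) = a0 + sumn (map S a).
Proof.
elim: a a0 c => [|a1 a IH] a0 [|x c] //= [sc] /andP[xl cl].
by case: (lettersP xl) => -> /=; rewrite IH //; lia.
Qed.

(* [r] is the distance between the current terminal [b] of the smaller diagram
   and the terminal [d] of the original one. *)
Lemma psums_refine b r d a0 a c : b + r = d ->
  size c = size a -> all (mem letters) c ->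
  psums b (refine (a0 + r) a c) =i
    b :: mask (unzip1 c) (cuts d a0 a) ++
    map predn (rcons (mask (unzip2 c) (cuts d a0 a)) (d + sumn (a0.+1 :: map S a))).
Proof.
elim: a b r d a0 c => [|a1 a IH] b r d a0 [|x c] // ed.
  by move=> _ _ y; rewrite /= !inE; congr (_ || (y == _)); lia.
case=> sc /andP[xl cl] y.
pose d' := d + a0.+1.
have eN : d + sumn (a0.+1 :: map S (a1 :: a)) = d' + sumn (a1.+1 :: map S a).
  by rewrite /d' /= addnA.
rewrite {}eN [cuts _ _ _]/= -/d'.
case: (lettersP xl) => -> {x xl}.
(* Vertical edge alone: the smaller diagram has its terminal at [d'] itself, so the distance returns
   to 0. *)
- rewrite [refine _ _ _]/= [unzip1 _]/= [unzip2 _]/= ![mask _ _]/= [psums _ _]/= !addn0.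
  have -> : b + (a0 + r + 1) = d' by rewrite /d'; lia.
  have := IH d' 0 d' a1 c (addn0 _) sc cl y; rewrite addn0 => IHy.
  by rewrite inE [in LHS]inE IHy !inE; case: (y == d'); rewrite ?orbT.
(* Horizontal edge alone: the terminal is at [d'.-1], at distance 1. *)
- rewrite [refine _ _ _]/= [unzip1 _]/= [unzip2 _]/= ![mask _ _]/= [psums _ _]/= !addn0.
  have -> : b + (a0 + r) = d'.-1 by rewrite /d'; lia.
  rewrite inE [in LHS]inE (IH d'.-1 1 d') //; last by rewrite /d'; lia.
  rewrite !(inE, mem_cat, rcons_cons, map_cons).
  by case: (y == b); case: (y == d'.-1); case: (y \in mask _ _); rewrite ?orbT.
(* Both edges: terminals at [d'.-1] and [d'], separated by the new part 1, and distance 0 again. *)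
- rewrite [refine _ _ _]/= [unzip1 _]/= [unzip2 _]/= ![mask _ _]/= [psums _ _]/= !addn0.
  have -> : b + (a0 + r) = d'.-1 by rewrite /d'; lia.
  have -> : d'.-1 + 1 = d' by rewrite /d'; lia.
  have := IH d' 0 d' a1 c (addn0 _) sc cl y; rewrite addn0 => IHy.
  rewrite inE [in LHS]inE IHy.
  rewrite !(inE, mem_cat, rcons_cons, map_cons).
  by case: (y == b); case: (y == d'.-1); case: (y == d');
     case: (y \in mask _ _); rewrite ?orbT.
Qed.

Lemma nboth_count (c : seq (bool * bool)) : all (mem letters) c ->
  count id (unzip1 c) + count id (unzip2 c) = size c + nboth c.
Proof.
rewrite /nboth; elim: c => //= x c IH /andP[/lettersP xl /IH {}IH].
by case: xl => -> /=; lia.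
Qed.

(** * Sorting faces by the edges that enter their terminals *)

Section LastStep.
Variables (n : nat) (xs : seq nat).
Hypothesis xs_path : path ltn 0 (rcons xs n.+1).

Let T := 0 :: rcons xs n.+1.
(** The extreme terminals leave no choice: [0] is entered vertically and [n.+1] horizontally. The
    word [c] decides for the inner ones. *)
Let V (c : seq (bool * bool)) := 0 :: mask (unzip1 c) xs.
Let H (c : seq (bool * bool)) := rcons (mask (unzip2 c) xs) n.+1.

Let xs_facts : [/\ uniq T, {in xs, forall x, 0 < x} & {in xs, forall x, x <= n}].
Proof.
have tr : transitive ltn by move=> x y z; apply: ltn_trans.
have sT : sorted ltn T := xs_path.
split; first by apply: sorted_uniq sT => // x; apply: ltnn.
  move: sT; rewrite sorted_pairwise // => /andP[/allP h _] x hx.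
  by apply: h; rewrite mem_rcons inE hx orbT.
move: sT; rewrite sorted_pairwise // /T pairwise_cons => /andP[_].
by rewrite pairwise_rcons => /andP[/allP h _] x /h.
Qed.

Let uT : uniq T. Proof. by case: xs_facts. Qed.
Let xs_gt0 x : x \in xs -> 0 < x. Proof. by case: xs_facts => _ h _ /h. Qed.
Let xs_le x : x \in xs -> x <= n. Proof. by case: xs_facts => _ _ h /h. Qed.

Let uxs : uniq xs.
Proof. by move: uT; rewrite /T /= rcons_uniq => /and3P[]. Qed.

Let V_le c x : x \in V c -> x <= n.
Proof. by rewrite inE => /predU1P[->|/mem_mask/xs_le]. Qed.

Let H_gt0 c x : x \in H c -> 0 < x.
Proof. by rewrite mem_rcons inE => /predU1P[->|/mem_mask/xs_gt0]. Qed.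

Let H_le c x : x \in H c -> x <= n.+1.
Proof. by rewrite mem_rcons inE => /predU1P[->|/mem_mask/xs_le/leqW]. Qed.

Let uV c : uniq (V c).
Proof.
rewrite /V /= mask_uniq // andbT; apply/negP=> /mem_mask/xs_gt0.
by [].
Qed.

Let uH c : uniq (H c).
Proof.
rewrite /H rcons_uniq mask_uniq // andbT; apply/negP=> /mem_mask/xs_le.
by rewrite ltnn.
Qed.

Let TE c : c \in words (size xs) -> T =i V c ++ H c.
Proof.
rewrite mem_words => /andP[/eqP sc cl] x.
rewrite /T /V /H mem_cat !inE !mem_rcons !inE !in_mask //.
have [xx|//] := boolP (x \in xs); last by rewrite !orbF.
have ix : index x xs < size c by rewrite sc index_mem.
rewrite !(nth_map (false, false)) //=.
have /lettersP := allP cl _ (mem_nth (false, false) ix).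
by case=> ->; rewrite /= ?orbT.
Qed.

Let sizeVH c : c \in words (size xs) -> size (V c) + size (H c) - size T = nboth c.
Proof.
rewrite mem_words => /andP[/eqP sc cl]; rewrite /V /H /T /= !size_rcons.
rewrite !size_mask ?size_map //; have := nboth_count cl; rewrite sc; lia.
Qed.

Let choice (g : subgraph n.+1) : seq (bool * bool) :=
  [seq (tope_v n x \in g.2, tope_h n x \in g.2) | x <- xs].

Let in_edge (g : subgraph n.+1) x : locface T g -> x <= n.+1 -> x \in T ->
  x <= n /\ tope_v n x \in g.2 \/ 0 < x /\ tope_h n x \in g.2.
Proof.
move=> F xn xT; have lx := topv_lvl xn.
have gx : topv n x \in g.1 by rewrite (lf_top F lx) topv1.
have [|u ux] := lf_in F gx; first by rewrite lx.
have [_ _ /orP[]] := lf_edge F ux => sux; [left|right].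
  by have [] := vstep_top lx sux; rewrite topv1 // => h <-.
by have [] := hstep_top lx sux; rewrite topv1 // => h <-.
Qed.

Let edge_in (g : subgraph n.+1) u x : locface T g -> x <= n.+1 ->
  (u, topv n x) \in g.2 -> x \in T.
Proof.
move=> F xn /(lf_edge F)[_ gx _].
by rewrite -(topv1 xn) -(lf_top F) // topv_lvl.
Qed.

(** The letter [(false, false)] cannot occur, because a terminal of positive level has an incoming
    edge. *)
Let choice_words g : locface T g -> choice g \in words (size xs).
Proof.
move=> F; rewrite mem_words size_map eqxx /=; apply/allP=> y /mapP[x hx ->].
have [] := @in_edge g x F.
- exact/leqW/xs_le.
- by rewrite /T inE mem_rcons inE hx !orbT.
- by case=> _ ->; case: (_ \in _).
- by case=> _ ->; case: (_ \in _).
Qed.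

(** At inner terminals the tests of [hasTopP] spell out the word. At the extreme terminals and away
    from the terminals, [in_edge] and [edge_in] settle them for every local face. *)
Let hasTop_choice c g : c \in words (size xs) -> locface T g ->
  hasTop (V c) (H c) g = (c == choice g).
Proof.
move=> cw F; have F' := eq_locface (TE cw) F.
have sc : size c = size xs by move: cw; rewrite mem_words => /andP[/eqP].
have xsT x : x \in xs -> x \in T by rewrite /T inE mem_rcons inE => ->; rewrite !orbT.
apply/(hasTopP _ _ F)/eqP => [[hV hH]|ec].
  apply: (@eq_from_nth _ (false, false)) => [|i ic]; first by rewrite size_map.
  have ix : i < size xs by rewrite -sc.
  rewrite (nth_map 0) //; set x := nth 0 xs i.
  have xx : x \in xs by rewrite mem_nth.
  have x0 := xs_gt0 xx; have xn := xs_le xx.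
  rewrite hV // hH ?leqW // /V /H mem_rcons !inE.
  rewrite [x == 0]gtn_eqF // [x == n.+1]ltn_eqF //= !in_mask // xx index_uniq //=.
  by rewrite !(nth_map (false, false)) //; case: (nth _ _ _).
have eV : mask (unzip1 c) xs = [seq x <- xs | tope_v n x \in g.2].
  by rewrite filter_mask ec /choice /unzip1 -map_comp.
have eH : mask (unzip2 c) xs = [seq x <- xs | tope_h n x \in g.2].
  by rewrite filter_mask ec /choice /unzip2 -map_comp.
rewrite /V /H eV eH; split=> x.
  move=> xn; rewrite inE mem_filter; have [->|x0] := eqVneq x 0.
    (* Only a vertical edge can enter the terminal with first coordinate 0, and [in_edge] supplies
       it. *)
    by have [[]|[]] := in_edge F (leq0n n.+1) (mem_head _ _).
  rewrite /= andb_idr // => /(edge_in F (leqW xn)).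
  by rewrite /T inE mem_rcons inE (negPf x0) [x == n.+1]ltn_eqF.
move=> x0 xn; rewrite mem_rcons inE mem_filter; have [->|xN] := eqVneq x n.+1.
  have [||[]|[]//] := @in_edge g n.+1 F => //; last by rewrite ltnn.
  by rewrite /T inE mem_rcons mem_head orbT.
rewrite /= andb_idr // => /(edge_in F xn).
by rewrite /T inE mem_rcons inE (negPf xN) [x == 0]gtn_eqF.
Qed.

(** Each local face realises exactly one word, [choice g], so the sum splits into one instance of
    [layer_sum] per word. *)
Lemma locpoly_recursion :
  (locpoly n.+1 T = \sum_(c <- words (size xs))
     'X^(nboth c) * locpoly n (V c ++ map predn (H c)))%R.
Proof.
transitivity (\sum_(c <- words (size xs))
  \sum_(g : subgraph n.+1 | locfaceb T g && hasTop (V c) (H c) g)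
    'X^(fdim n.+1 g) : {poly rat})%R.
  rewrite (exchange_big_dep (fun g => locfaceb T g)) /=; last by move=> c g _ /andP[].
  apply: eq_bigr => g /[dup] Tg /locfaceP F; rewrite big_seq_cond.
  rewrite (eq_bigl (fun c => (c \in words (size xs)) && (c == choice g))); last first.
    by move=> c; rewrite Tg; apply: andb_id2l => cw; rewrite hasTop_choice.
  rewrite -big_seq_cond -big_filter (filter_pred1_uniq (words_uniq _) (choice_words F)).
  by rewrite big_seq1.
rewrite !big_seq; apply: eq_bigr => c cw; rewrite -(sizeVH cw).
by rewrite (layer_sum (@V_le c) (@H_gt0 c) (@H_le c) (uV c) (uH c) uT (TE cw)).
Qed.

End LastStep.

(** By [psums_refine] the tails of the prescribed edges are the terminals for the parts
    [refine a0 a c], whose sum is one smaller. *)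
Lemma Fpoly_recursion a0 a :
  (Fpoly (a0.+1 :: map S a) = \sum_(c <- words (size a))
     'X^(nboth c) * Fpoly (refine a0 a c))%R.
Proof.
rewrite FpolyE psums_cuts add0n -[sumn _]/((a0 + sumn (map S a)).+1).
rewrite locpoly_recursion; last exact: (path_cuts 0 a0 a).
rewrite size_cuts !big_seq; apply: eq_bigr => c.
rewrite mem_words => /andP[/eqP sc cl].
rewrite FpolyE sumn_refine //; congr (_ * _)%R; apply: eq_locpoly => x.
by have := @psums_refine 0 0 0 a0 a c (addn0 _) sc cl x; rewrite addn0 add0n => ->.
Qed.

Local Open Scope ring_scope.

Theorem theorem1p2 (s : nat) (hs : (0 < s)%N) (a : {ffun 'I_s -> nat}) :
  yzero s (Dop s (Psi (s.*2.-1))) a = 0.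
Proof.
case ea: [seq a i | i <- enum 'I_s] => [|a0 a'].
  by have := congr1 size ea; rewrite size_map size_enum_ord /=; lia.
have sz : s = (size a').+1 by rewrite -(size_enum_ord s) -(size_map a) ea.
rewrite /yzero /Dop /fsub -[Psi _]/(egf Fpoly) dmixed_egf dprod_egf /egf (map_ystar ea).
have sz1 : iota 0 s = iota 0 (size a').+1 by rewrite -sz.
have sz2 : iota 0 s.-1 = iota 0 (size a') by congr iota; lia.
(* Both terms carry the same inverse factorials, since the shifts act only on the argument of
   [Fpoly]; this scalar factors out. *)
rewrite -scalerBr sz1 sz2 foldr_shiftx_spread foldr_shiftxy_spread.
by rewrite Fpoly_spread Fpoly_recursion subrr scaler0.
Qed.
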